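(* Let $Q(t)\in\mathbb{C}^{N\times N}$ be a sufficiently smooth matrix-valued function of a real variable, and consider the linear system $\frac{dx}{dt}=Q(t)x$, $x(t)\in\mathbb{C}^N$. Fix $s\in\mathbb{R}$, put $\overline{s}=s-1$, and fix a point $t$; for a step $\tau>0$ let $t_n=t+\overline{s}\tau$ and $t_{n+1}=t+s\tau$. Then a one-step finite-difference scheme $x_{n+1}=Tx_n$, with transition matrix $T=T(\tau)\in\mathbb{C}^{N\times N}$, approximates the equation with fourth order of accuracy if and only if $T$ has the expansion $$T=E+\tau Q+\tau^2T_2+\tau^3T_3+\tau^4T_4+O(\tau^5)\qquad(\tau\to0),$$ where $$T_2=\frac{2s-1}{2!}Q_2-\overline{s}Q^2,$$ $$T_3=\frac{3s^2-3s+1}{3!}Q_3-\frac{\overline{s}^2}{2!}QQ_2-\frac{(2s-1)\overline{s}}{2!}Q_2Q+\overline{s}^2Q^3,$$ $$T_4=\frac{(2s-1)(2s^2-2s+1)}{4!}Q_4-\frac{\overline{s}^3}{3!}QQ_3-\frac{\overline{s}^2}{2!}T_2Q_2-\overline{s}T_3Q,$$ and $$Q_2=Q^{(1)}+Q^2,$$ $$Q_3=Q^{(2)}+2Q^{(1)}Q+QQ^{(1)}+Q^3,$$ $$Q_4=Q^{(3)}+3Q^{(2)}Q+QQ^{(2)}+3(Q^{(1)})^2+3Q^{(1)}Q^2+2QQ^{(1)}Q+Q^2Q^{(1)}+Q^4,$$ with $Q$ and its derivatives all evaluated at the point $t$.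
   Context: $E$ is the identity matrix and $Q^{(k)}=d^kQ/dt^k$. The scheme $x_{n+1}=Tx_n$ is said to approximate the equation with fourth order of accuracy if, with $t$ and $s$ fixed, for every exact solution $x(\cdot)$ of $dx/dt=Q(t)x$ one has $x(t_{n+1})=T\,x(t_n)+O(\tau^5)$ as $\tau\to0$, where $t_{n+1}-t_n=\tau$. *)

(* Defs.v *)
From mathcomp Require Export all_boot all_order all_algebra.
From mathcomp Require Export all_classical all_reals all_analysis.
From mathcomp Require Export complex.
Export Order.TTheory GRing.Theory Num.Theory.
Export numFieldNormedType.Exports.

Set Implicit Arguments.
Unset Strict Implicit.
Unset Printing Implicit Defensive.

Local Open Scope classical_set_scope.
Local Open Scope ring_scope.
Local Open Scope complex_scope.

(* Calculus of a real variable with values in a complex normed space V.  The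
   library's [derivable] and [derive1] need the variable to range over the
   field of scalars of V, which is R[i] for complex vectors and matrices; the
   definitions below are theirs with the real increment h embedded in R[i]. *)
Section RealVariable.
Context {R : realType} {V : normedModType R[i]}.
Implicit Types f : R -> V.

Definition cquot f (t h : R) : V := (h^-1)%:C *: (f (h + t) - f t).

Definition cderivable f (t : R) : Prop := cvg (cquot f t @ 0^').

Definition cderive f (t : R) : V := lim (cquot f t @ 0^').

Definition cderiven (k : nat) f : R -> V := iter k cderive f.

Definition of_class_C (n : nat) f : Prop :=
  (forall k, (k < n)%N -> forall t, cderivable (cderiven k f) t) /\
  continuous (cderiven n f).

End RealVariable.

Section Scheme.
Context {R : realType} {N : nat}.
Implicit Types (Q T : R -> 'M[R[i]]_N) (x : R -> 'cV[R[i]]_N).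

Definition solution Q x : Prop :=
  forall t, cderivable x t /\ cderive x t = Q t *m x t.

(* tau ^ n as a gauge for Landau symbols; R[i]^o is R[i] as a normed space over
   itself. *)
Definition powC (n : nat) (tau : R) : R[i]^o := (tau ^+ n)%:C.

(* x(t_(n+1)) = T x(t_n) + O(tau ^ (p + 1)) as tau -> 0, tau > 0, with
   t_n = t + (s - 1) tau and t_(n+1) = t + s tau; the values of T at
   tau <= 0 play no role. *)
Definition approximates_with_order (p : nat) Q (t s : R) T : Prop :=
  forall x, solution Q x ->
    (fun tau => x (t + s * tau)) =
    (fun tau => T tau *m x (t + (s - 1) * tau)) +O_ (0^'+) (powC p.+1).

End Scheme.

(* Main.v *)
Require Import Defs.
From mathcomp Require Import ring lra.

Local Open Scope classical_set_scope.
Local Open Scope ring_scope.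
Local Open Scope complex_scope.

(* A solution satisfies x^(k) = G_k x with G_0 = 1 and G_(k+1) = G_k' + G_k Q,
   and G_2, G_3, G_4 are the matrices Q_2, Q_3, Q_4 of the statement.  Taylor's
   formula at t thus expands x(t + a tau) as
   (sum_k (a tau)^k / k! G_k) x(t) + O(tau^5), and T_2, T_3, T_4 are defined so
   that, with P = 1 + tau Q + ... + tau^4 T_4, the product of P with the
   expansion for a = s - 1 reproduces the expansion for a = s up to O(tau^5).
   This gives the "if" part.  Conversely, let X be the global solution with
   X(t) = 1 (Picard iteration); applying the scheme to its columns gives
   (T - P) X(t + (s - 1) tau) = O(tau^5), and X(t + (s - 1) tau) = 1 + O(tau)
   can be cancelled. *)

(** * An entrywise norm on complex matrices *)

Section EntrywiseNorm.
Context {R : realType}.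
Implicit Types z w : R[i].

(** Norms of complex matrices take values in [R[i]], and the maximum norm is submultiplicative only
    up to a factor, whereas the mean value theorem and integration concern functions from R to R.
    The analysis is therefore done on real and imaginary parts of entries and measured by the
    real-valued [mnorm1]. A bound passed from components to a matrix costs a factor
    [(m * n)%:R * 2], harmless inside an O but to be beaten in the Picard estimate. A [solution]
    lives on the whole line, so a solution near t alone could not be fed to the scheme: existence
    has to be global. The test object is a full matrix X, because one vector x controls T - P only
    in the direction of x(t_n). The T_k arise by comparing powers of tau: s^k/k! G_k is the sum over
    j <= k of T_j G_(k-j) (s-1)^(k-j)/(k-j)!, solved for T_k with T_0 = 1. *)

Definition cnorm1 z : R := `|complex.Re z| + `|complex.Im z|.

Definition mnorm1 {m n} (A : 'M[R[i]]_(m, n)) : R :=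
  \sum_i \sum_j cnorm1 (A i j).

Lemma ReD z w : complex.Re (z + w) = complex.Re z + complex.Re w.
Proof. by case: z; case: w. Qed.
Lemma ImD z w : complex.Im (z + w) = complex.Im z + complex.Im w.
Proof. by case: z; case: w. Qed.
Lemma ReN z : complex.Re (- z) = - complex.Re z.
Proof. by case: z. Qed.
Lemma ImN z : complex.Im (- z) = - complex.Im z.
Proof. by case: z. Qed.
Lemma ReM z w : complex.Re (z * w) =
  complex.Re z * complex.Re w - complex.Im z * complex.Im w.
Proof. by case: z; case: w. Qed.
Lemma ImM z w : complex.Im (z * w) =
  complex.Re z * complex.Im w + complex.Im z * complex.Re w.
Proof. by case: z; case: w. Qed.
Lemma Re_sum I (r : seq I) (P : pred I) (F : I -> R[i]) :
  complex.Re (\sum_(i <- r | P i) F i) = \sum_(i <- r | P i) complex.Re (F i).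
Proof. by elim/big_rec2 : _ => //= i x y _ <-; rewrite ReD. Qed.
Lemma Im_sum I (r : seq I) (P : pred I) (F : I -> R[i]) :
  complex.Im (\sum_(i <- r | P i) F i) = \sum_(i <- r | P i) complex.Im (F i).
Proof. by elim/big_rec2 : _ => //= i x y _ <-; rewrite ImD. Qed.

Lemma cnorm1_ge0 z : 0 <= cnorm1 z.
Proof. exact: addr_ge0. Qed.

Lemma ler_cnorm1D z w : cnorm1 (z + w) <= cnorm1 z + cnorm1 w.
Proof.
by rewrite /cnorm1 ReD ImD addrACA lerD// ler_normD.
Qed.

Lemma ler_cnorm1M z w : cnorm1 (z * w) <= cnorm1 z * cnorm1 w.
Proof.
rewrite /cnorm1 ReM ImM.
apply: (@le_trans _ _ ((`|complex.Re z| * `|complex.Re w| +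
   `|complex.Im z| * `|complex.Im w|) + (`|complex.Re z| * `|complex.Im w| +
   `|complex.Im z| * `|complex.Re w|))).
  rewrite -!normrM lerD// ?ler_normD//.
  by rewrite (le_trans (ler_normB _ _)).
by rewrite le_eqVlt; apply/orP; left; apply/eqP; ring.
Qed.

Lemma ler_normc_cnorm1 z : `|z| <= (cnorm1 z)%:C.
Proof.
rewrite normc_def lecR -[leRHS]ger0_norm ?cnorm1_ge0// -sqrtr_sqr ler_wsqrtr//.
rewrite /cnorm1 sqrrD !real_normK ?num_real// addrAC.
by rewrite lerDl mulrn_wge0// mulr_ge0.
Qed.

Lemma ler_cnorm1_normc z : cnorm1 z <= 2 * complex.Re `|z|.
Proof.
rewrite normc_def /= /cnorm1 mulr2n mulrDl mul1r.
have H (x y : R) : `|x| <= Num.sqrt (x ^+ 2 + y ^+ 2).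
  by rewrite -sqrtr_sqr ler_wsqrtr// lerDl sqr_ge0.
by apply: lerD => //; rewrite addrC.
Qed.

Context {m n p : nat}.
Implicit Types A B : 'M[R[i]]_(m, n).

Lemma mnorm1_ge0 A : 0 <= mnorm1 A.
Proof. by do 2 apply: sumr_ge0 => ? _; exact: cnorm1_ge0. Qed.

Lemma ler_entry_mnorm1 A i j : cnorm1 (A i j) <= mnorm1 A.
Proof.
rewrite /mnorm1 (bigD1 i)//= (bigD1 j)//= -addrA lerDl addr_ge0//.
  by apply: sumr_ge0 => ? _; exact: cnorm1_ge0.
by do 2 apply: sumr_ge0 => ? _; exact: cnorm1_ge0.
Qed.

Lemma ler_Re_mnorm1 A i j : `|complex.Re (A i j)| <= mnorm1 A.
Proof. by apply: le_trans (ler_entry_mnorm1 A i j); rewrite lerDl. Qed.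

Lemma ler_Im_mnorm1 A i j : `|complex.Im (A i j)| <= mnorm1 A.
Proof. by apply: le_trans (ler_entry_mnorm1 A i j); rewrite lerDr. Qed.

(** The factor counts the real components of the matrix: one real and one imaginary part per
    entry. *)
Lemma mnorm1_le A (M : R) :
  (forall i j, `|complex.Re (A i j)| <= M) ->
  (forall i j, `|complex.Im (A i j)| <= M) ->
  mnorm1 A <= (m * n)%:R * 2 * M.
Proof.
move=> hR hI; apply: (@le_trans _ _ (\sum_(i < m) \sum_(j < n) (2 * M))).
  apply: ler_sum => i _; apply: ler_sum => j _.
  by rewrite mulr2n mulrDl mul1r lerD.
by rewrite !sumr_const !card_ord -mulrnA -[leLHS]mulr_natl mulnC mulrA.
Qed.

Lemma mnorm10 : mnorm1 (0 : 'M[R[i]]_(m, n)) = 0.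
Proof.
rewrite /mnorm1 big1// => i _; rewrite big1// => j _.
by rewrite mxE /cnorm1 /= normr0 addr0.
Qed.

Lemma ler_mnorm1D A B : mnorm1 (A + B) <= mnorm1 A + mnorm1 B.
Proof.
rewrite /mnorm1 -big_split/= ler_sum// => i _.
by rewrite -big_split/= ler_sum// => j _; rewrite mxE ler_cnorm1D.
Qed.

Lemma mnorm1N A : mnorm1 (- A) = mnorm1 A.
Proof.
rewrite /mnorm1; do 2 apply: eq_bigr => ? _.
by rewrite mxE /cnorm1 ReN ImN !normrN.
Qed.

Lemma mnorm1Z (x : R) A : mnorm1 (x%:C *: A) = `|x| * mnorm1 A.
Proof.
rewrite /mnorm1 mulr_sumr; apply: eq_bigr => i _.
rewrite mulr_sumr; apply: eq_bigr => j _.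
by rewrite mxE /cnorm1 ReM ImM /= !mul0r subr0 addr0 !normrM mulrDr.
Qed.

Lemma mnorm1_eq0 A : mnorm1 A <= 0 -> A = 0.
Proof.
move=> A0; apply/matrixP => i j; rewrite mxE.
have := le_trans (ler_Re_mnorm1 A i j) A0; have := le_trans (ler_Im_mnorm1 A i j) A0.
rewrite !normr_le0; case: (A i j) => a b /= /eqP -> /eqP -> //.
Qed.

(** In the sum over i, j, k of |a_ij| |b_jk|, the sum over k is one row sum of B, hence at most the
    norm of all of B. *)
Lemma ler_mnorm1M A (B : 'M[R[i]]_(n, p)) :
  mnorm1 (A *m B) <= mnorm1 A * mnorm1 B.
Proof.
rewrite [leLHS](_ : _ = \sum_i \sum_k cnorm1 (\sum_j A i j * B j k)); last first.
  by do 2 apply: eq_bigr => ? _; rewrite mxE.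
rewrite mulr_suml; apply: ler_sum => i _.
apply: (@le_trans _ _ (\sum_j \sum_k cnorm1 (A i j) * cnorm1 (B j k))).
  rewrite exchange_big/=; apply: ler_sum => k _.
  elim/big_ind2 : _ => [|x1 x2 y1 y2 h1 h2|j _].
  - by rewrite /cnorm1 normr0 addr0.
  - by rewrite (le_trans (ler_cnorm1D _ _))// lerD.
  - exact: ler_cnorm1M.
rewrite mulr_suml; apply: ler_sum => j _; rewrite -mulr_sumr.
rewrite ler_wpM2l ?cnorm1_ge0// /mnorm1 (bigD1 j)//= lerDl.
by do 2 apply: sumr_ge0 => ? _; exact: cnorm1_ge0.
Qed.

Lemma ler_norm_mnorm1 A : `|A| <= (mnorm1 A)%:C.
Proof.
have A0 : 0 <= (mnorm1 A)%:C by rewrite ler0c mnorm1_ge0.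
rewrite /Num.norm /= mx_normE -[leRHS]/((NngNum A0)%:num) num_le.
apply/bigmax_leP; split=> [|i _]; rewrite -num_le//=.
by rewrite (le_trans (ler_normc_cnorm1 _))// lecR ler_entry_mnorm1.
Qed.

Lemma ler_entry_norm A i j : `|A i j| <= `|A|.
Proof.
rewrite [leRHS]/Num.norm /= mx_normE.
have /= -> : `|A i j| = (`|A (i, j).1 (i, j).2|%:nng)%:num by [].
rewrite num_le; apply/bigmax_geP; right => /=.
by exists (i, j) => //; rewrite -num_le.
Qed.

Lemma ler_mnorm1_norm A : mnorm1 A <= (m * n)%:R * 2 * (2 * complex.Re `|A|).
Proof.
have H i j : cnorm1 (A i j) <= 2 * complex.Re `|A|.
  rewrite (le_trans (ler_cnorm1_normc _))// ler_pM2l//.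
  by have := ler_entry_norm A i j; rewrite lecE => /andP[].
by apply: mnorm1_le => i j; apply: le_trans (H i j); rewrite (lerDl,lerDr).
Qed.

End EntrywiseNorm.

(** * Entrywise derivatives *)

Section EntrywiseDerivative.
Context {R : realType}.

(** Real and imaginary parts of entries are functions from R to R, where the rules of scalar
    calculus apply; [cderivP] identifies this notion with the derivative in the matrix space. *)
Definition mderiv {m n} (f : R -> 'M[R[i]]_(m, n)) (t : R)
    (l : 'M[R[i]]_(m, n)) : Prop :=
  (forall i j, is_derive t (1 : R) (fun u => complex.Re (f u i j) : R)
                 (complex.Re (l i j))) /\
  (forall i j, is_derive t (1 : R) (fun u => complex.Im (f u i j) : R)
                 (complex.Im (l i j))).

Lemma is_derive1P (f : R -> R) (t l : R) :
  is_derive t (1 : R) f l <->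
  ((fun h => h^-1 * (f (h + t) - f t)) @ 0^' --> l).
Proof.
have E : (fun h => h^-1 *: ((f \o shift t) (h *: (1 : R)) - f t)) =
         (fun h => h^-1 * (f (h + t) - f t)).
  by apply/funext => h /=; rewrite /GRing.scale /= mulr1.
rewrite -E; split=> [[df <-]|cf]; first exact: df.
split; first by apply/cvg_ex; exists l.
by apply: cvg_lim => //; exact: Rhausdorff.
Qed.

(* The topology of a complex matrix space is only found through its normed
   module structure. *)
Local Notation nmod m n := ('M[R[i]]_(m, n) : normedModType R[i]).

Lemma cvg_mnorm1P {T : Type} {F : set_system T} {FF : ProperFilter F} {m n}
    (f : T -> 'M[R[i]]_(m, n)) (l : 'M[R[i]]_(m, n)) :
  (f : T -> nmod m n) @ F --> (l : nmod m n) <-> (fun x => mnorm1 (l - f x)) @ F --> (0 : R).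
Proof.
split => [/cvgrPdist_lt fl|/cvgr0Pnorm_lt fl].
- apply/cvgr0Pnorm_lt => e e0.
  (* Comparing [mnorm1] with the maximum norm loses the factor 4mn; the added 1 keeps [c] positive
     for empty matrices. *)
  set c : R := (m * n)%:R * 2 * 2 + 1.
  have c0 : 0 < c by rewrite /c ltr_wpDl// !mulr_ge0.
  have ec0 : 0 < (e / c)%:C by rewrite ltcR divr_gt0.
  have := fl _ ec0; apply: filterS => x lx.
  rewrite ger0_norm ?mnorm1_ge0//.
  have lx' : complex.Re `|l - f x| < e / c.
    by move: lx; rewrite ltcE => /andP[].
  rewrite (le_lt_trans (ler_mnorm1_norm _))// mulrA.
  have h0 : 0 <= complex.Re `|l - f x|.
    by have := normr_ge0 (l - f x); rewrite lecE => /andP[].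
  rewrite (@le_lt_trans _ _ (c * complex.Re `|l - f x|))//.
    by rewrite ler_wpM2r// lerDl.
  by rewrite mulrC -ltr_pdivlMr.
- apply/cvgrPdist_lt => e e0.
  (* A positive element of [R[i]] is real, so [e] provides a real radius. *)
  have eE : (complex.Re e)%:C = e by apply: RRe_real; rewrite gtr0_real.
  have e0' : 0 < complex.Re e by rewrite -ltcR eE.
  have := fl _ e0'; apply: filterS => x lx.
  rewrite -eE (le_lt_trans (ler_norm_mnorm1 _))// ltcR.
  by rewrite ger0_norm ?mnorm1_ge0// in lx.
Qed.

Lemma cvg_entryP {T : Type} {F : set_system T} {FF : ProperFilter F} {m n}
    (f : T -> 'M[R[i]]_(m, n)) (l : 'M[R[i]]_(m, n)) :
  (f : T -> nmod m n) @ F --> (l : nmod m n) <->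
  (forall i j, (fun x => complex.Re (f x i j)) @ F --> complex.Re (l i j)) /\
  (forall i j, (fun x => complex.Im (f x i j)) @ F --> complex.Im (l i j)).
Proof.
rewrite cvg_mnorm1P; split=> [fl|[re im]].
- split=> i j; apply/cvgrPdist_lt => e e0; move/cvgr0Pnorm_lt: fl => /(_ _ e0);
    apply: filterS => x; rewrite ger0_norm ?mnorm1_ge0//; apply: le_lt_trans.
  + by have := ler_Re_mnorm1 (l - f x) i j; rewrite !mxE ReD ReN.
  + by have := ler_Im_mnorm1 (l - f x) i j; rewrite !mxE ImD ImN.
- have -> : (0 : R) = \sum_(i < m) \sum_(j < n) 0.
    by rewrite big1// => i _; rewrite big1.
  apply: cvg_big => [|i _]; first exact: add_continuous.
  apply: cvg_big => [|j _]; first exact: add_continuous.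
  rewrite -[X in _ --> X](addr0 0); apply: cvgD.
    apply/norm_cvg0P; rewrite -(subrr (complex.Re (l i j))).
    under eq_fun do rewrite !mxE ReD ReN.
    by apply: cvgB => //; exact: cvg_cst.
  apply/norm_cvg0P; rewrite -(subrr (complex.Im (l i j))).
  under eq_fun do rewrite !mxE ImD ImN.
  by apply: cvgB => //; exact: cvg_cst.
Qed.

Lemma cvg_cquotP {m n} (f : R -> 'M[R[i]]_(m, n)) (t : R) l :
  ((cquot f t : R -> nmod m n) @ 0^' --> (l : nmod m n)) <-> mderiv f t l.
Proof.
rewrite cvg_entryP /mderiv.
have ER i j : (fun h => complex.Re (cquot f t h i j)) =
    (fun h => h^-1 * (complex.Re (f (h + t) i j) - complex.Re (f t i j))).
  by apply/funext => h; rewrite /cquot !mxE ReM /= mul0r subr0 ReD ReN.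
have EI i j : (fun h => complex.Im (cquot f t h i j)) =
    (fun h => h^-1 * (complex.Im (f (h + t) i j) - complex.Im (f t i j))).
  by apply/funext => h; rewrite /cquot !mxE ImM /= mul0r addr0 ImD ImN.
split=> -[re im]; split=> i j.
- by apply/is_derive1P; rewrite -ER; exact: re.
- by apply/is_derive1P; rewrite -EI; exact: im.
- by rewrite ER; apply/is_derive1P.
- by rewrite EI; apply/is_derive1P.
Qed.

Lemma cderivP {m n} (f : R -> 'M[R[i]]_(m, n)) (t : R) l :
  (cderivable f t /\ cderive f t = l) <-> mderiv f t l.
Proof.
rewrite -cvg_cquotP; split=> [[df <-]|cf]; first exact: df.
split; first by apply/cvg_ex; exists l.
by apply: cvg_lim => //; exact: norm_hausdorff.
Qed.

Lemma mderiv_eq {m n} (f : R -> 'M[R[i]]_(m, n)) t l l' :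
  mderiv f t l -> l = l' -> mderiv f t l'.
Proof. by move=> ? <-. Qed.

Lemma mderiv_cst {m n} (A : 'M[R[i]]_(m, n)) t : mderiv (fun=> A) t 0.
Proof.
by split=> i j; rewrite mxE; exact: is_derive_cst.
Qed.

Lemma mderivD {m n} (f g : R -> 'M[R[i]]_(m, n)) t l k :
  mderiv f t l -> mderiv g t k -> mderiv (fun u => f u + g u) t (l + k).
Proof.
move=> [fr fi] [gr gi]; split=> i j.
- rewrite (_ : (fun _ => _) = (fun u => complex.Re (f u i j)) +
    (fun u => complex.Re (g u i j))).
    by rewrite mxE ReD; exact: is_deriveD.
  by apply/funext => u; rewrite mxE ReD.
- rewrite (_ : (fun _ => _) = (fun u => complex.Im (f u i j)) +
    (fun u => complex.Im (g u i j))).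
    by rewrite mxE ImD; exact: is_deriveD.
  by apply/funext => u; rewrite mxE ImD.
Qed.

Lemma mderivN {m n} (f : R -> 'M[R[i]]_(m, n)) t l :
  mderiv f t l -> mderiv (fun u => - f u) t (- l).
Proof.
move=> [fr fi]; split=> i j.
- rewrite (_ : (fun _ => _) = - (fun u => complex.Re (f u i j))).
    by rewrite mxE ReN; exact: is_deriveN.
  by apply/funext => u; rewrite mxE ReN.
- rewrite (_ : (fun _ => _) = - (fun u => complex.Im (f u i j))).
    by rewrite mxE ImN; exact: is_deriveN.
  by apply/funext => u; rewrite mxE ImN.
Qed.

Lemma mderivM {m n p} (f : R -> 'M[R[i]]_(m, n)) (g : R -> 'M[R[i]]_(n, p))
    t l k : mderiv f t l -> mderiv g t k ->
  mderiv (fun u => f u *m g u) t (l *m g t + f t *m k).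
Proof.
move=> [fr fi] [gr gi]; split=> i j.
- rewrite (_ : (fun _ => _) = \sum_(a < n)
    ((fun u => complex.Re (f u i a)) * (fun u => complex.Re (g u a j)) -
     (fun u => complex.Im (f u i a)) * (fun u => complex.Im (g u a j)))).
    apply: is_derive_eq; rewrite mxE ReD !mxE !Re_sum -big_split/=.
    by apply: eq_bigr => a _; rewrite !ReM /GRing.scale /=; ring.
  apply/funext => u; rewrite mxE Re_sum fct_sumE.
  by apply: eq_bigr => a _; rewrite ReM.
- rewrite (_ : (fun _ => _) = \sum_(a < n)
    ((fun u => complex.Re (f u i a)) * (fun u => complex.Im (g u a j)) +
     (fun u => complex.Im (f u i a)) * (fun u => complex.Re (g u a j)))).
    apply: is_derive_eq; rewrite mxE ImD !mxE !Im_sum -big_split/=.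
    by apply: eq_bigr => a _; rewrite !ImM /GRing.scale /=; ring.
  apply/funext => u; rewrite mxE Im_sum fct_sumE.
  by apply: eq_bigr => a _; rewrite ImM.
Qed.

Lemma mderivZ {m n} (a : R[i]) (f : R -> 'M[R[i]]_(m, n)) t l :
  mderiv f t l -> mderiv (fun u => a *: f u) t (a *: l).
Proof.
move=> df; have := mderivM _ _ _ _ _ (mderiv_cst (a%:M : 'M[R[i]]_m) t) df.
rewrite mul0mx add0r mul_scalar_mx.
by under eq_fun do rewrite mul_scalar_mx.
Qed.

Lemma mderiv_sum {m n} (I : Type) (r : seq I) (P : pred I)
    (f : I -> R -> 'M[R[i]]_(m, n)) t (l : I -> 'M[R[i]]_(m, n)) :
  (forall i, P i -> mderiv (f i) t (l i)) ->
  mderiv (fun u => \sum_(i <- r | P i) f i u) t (\sum_(i <- r | P i) l i).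
Proof.
move=> df; elim: r => [|i r IH].
  under eq_fun do rewrite big_nil.
  by rewrite big_nil; exact: mderiv_cst.
under eq_fun do rewrite big_cons.
by rewrite big_cons; case: ifPn => // Pi; apply: mderivD => //; exact: df.
Qed.

Lemma mderiv_scale_cst {m n} (c : R -> R) (t c' : R) (A : 'M[R[i]]_(m, n)) :
  is_derive t (1 : R) c c' ->
  mderiv (fun u => (c u)%:C *: A) t (c'%:C *: A).
Proof.
move=> dc; split=> i j.
- rewrite (_ : (fun _ => _) = complex.Re (A i j) \*: c).
    by rewrite mxE ReM /= mul0r subr0 mulrC; exact: is_deriveZ.
  by apply/funext => u; rewrite mxE ReM /= mul0r subr0 mulrC.
- rewrite (_ : (fun _ => _) = complex.Im (A i j) \*: c).
    by rewrite mxE ImM /= mul0r addr0 mulrC; exact: is_deriveZ.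
  by apply/funext => u; rewrite mxE ImM /= mul0r addr0 mulrC.
Qed.

End EntrywiseDerivative.

(** * Mean value inequality and Taylor's formula *)

Section MeanValue.
Context {R : realType}.

Lemma near0_norm_lt (d : R) : 0 < d -> \forall h \near (0 : R), `|h| < d.
Proof.
by move=> d0; apply/nbhs_ballP; exists d => //= h; rewrite /ball /= sub0r normrN.
Qed.

Lemma is_derive_continuous (f : R -> R) (x d : R) :
  is_derive x (1 : R) f d -> {for x, continuous f}.
Proof.
move=> df; apply: differentiable_continuous.
by apply/derivable1_diffP; exact: ex_derive.
Qed.

(** The mean value theorem is applied to g - f and g + f, whose derivatives are nonnegative, so
    neither function decreases from a to b. A majorant g, instead of a Lipschitz constant, is what
    the exponential weight of the Picard estimate calls for. *)
Lemma ler_dist_derive (f g f' g' : R -> R) (a b : R) : a <= b ->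
  (forall u, a <= u <= b -> is_derive u (1 : R) f (f' u)) ->
  (forall u, a <= u <= b -> is_derive u (1 : R) g (g' u)) ->
  (forall u, a <= u <= b -> `|f' u| <= g' u) ->
  `|f b - f a| <= g b - g a.
Proof.
move=> ab df dg le.
have in_ab (u : R) : u \in `[a, b] -> a <= u <= b by rewrite in_itv.
have in_oo (u : R) : u \in `]a, b[ -> a <= u <= b.
  by rewrite in_itv => /andP[/ltW -> /ltW ->].
have cont (h h' : R -> R) : (forall u, a <= u <= b -> is_derive u (1 : R) h (h' u)) ->
    {within `[a, b], continuous h}.
  move=> dh; apply: continuous_in_subspaceT => u; rewrite inE/= in_itv/= => uab.
  exact: is_derive_continuous (dh _ uab).
have dB u : a <= u <= b -> is_derive u (1 : R) (g - f) (g' u - f' u).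
  by move=> uab; apply: is_deriveB; [exact: dg|exact: df].
have dD u : a <= u <= b -> is_derive u (1 : R) (g + f) (g' u + f' u).
  by move=> uab; apply: is_deriveD; [exact: dg|exact: df].
have [c cab] := MVT_segment ab (fun u h => dB u (in_oo u h)) (cont _ _ dB).
have [c' cab'] := MVT_segment ab (fun u h => dD u (in_oo u h)) (cont _ _ dD).
have := le c (in_ab _ cab); have := le c' (in_ab _ cab').
rewrite !ler_norml => /andP[h1 h2] /andP[h3 h4].
rewrite !fctE => e1 e2.
have : 0 <= (g' c - f' c) * (b - a) by rewrite mulr_ge0//; lra.
have : 0 <= (g' c' + f' c') * (b - a) by rewrite mulr_ge0//; lra.
by rewrite -e1 -e2; lra.
Qed.

(** The mean value point depends on the component, so the scalar inequality is applied to each real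
    component separately. *)
Lemma ler_mnorm1_mderiv {m n} (F F' : R -> 'M[R[i]]_(m, n)) (g g' : R -> R)
    (a b : R) : a <= b ->
  (forall u, a <= u <= b -> mderiv F u (F' u)) ->
  (forall u, a <= u <= b -> is_derive u (1 : R) g (g' u)) ->
  (forall u, a <= u <= b -> mnorm1 (F' u) <= g' u) ->
  mnorm1 (F b - F a) <= (m * n)%:R * 2 * (g b - g a).
Proof.
move=> ab dF dg le; apply: mnorm1_le => i j.
- rewrite !mxE ReD ReN.
  apply: (ler_dist_derive (fun u => complex.Re (F u i j)) g
           (fun u => complex.Re (F' u i j)) g') => // u uab.
    by have [] := dF u uab.
  exact: le_trans (ler_Re_mnorm1 _ _ _) (le u uab).
- rewrite !mxE ImD ImN.
  apply: (ler_dist_derive (fun u => complex.Im (F u i j)) g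
           (fun u => complex.Im (F' u i j)) g') => // u uab.
    by have [] := dF u uab.
  exact: le_trans (ler_Im_mnorm1 _ _ _) (le u uab).
Qed.

Lemma ler_mnorm1_increment {m n} (F F' : R -> 'M[R[i]]_(m, n)) (t h B : R) :
  (forall u, `|u - t| <= `|h| -> mderiv F u (F' u)) ->
  (forall u, `|u - t| <= `|h| -> mnorm1 (F' u) <= B) ->
  mnorm1 (F (t + h) - F t) <= (m * n)%:R * 2 * (B * `|h|).
Proof.
move=> dF le.
have dg u : is_derive u (1 : R) (fun x : R => B * x) B.
  rewrite (_ : (fun x : R => B * x) = B \*: id)//.
  by apply: is_derive_eq; rewrite /GRing.scale /= mulr1.
have [h0|h0] := lerP 0 h.
- have H u : t <= u <= t + h -> `|u - t| <= `|h|.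
    by rewrite (ger0_norm h0) => /andP[u1 u2]; rewrite ger0_norm; lra.
  have tth : t <= t + h by rewrite lerDl.
  have -> : B * `|h| = B * (t + h) - B * t by rewrite ger0_norm//; ring.
  by apply: (ler_mnorm1_mderiv F F' (fun x => B * x) (fun=> B)) => // u /H;
     [exact: dF|exact: le].
- have H u : t + h <= u <= t -> `|u - t| <= `|h|.
    by rewrite (ltr0_norm h0) => /andP[u1 u2]; rewrite ler0_norm; lra.
  have tth : t + h <= t by rewrite gerDl ltW.
  have -> : B * `|h| = B * t - B * (t + h) by rewrite ltr0_norm//; ring.
  rewrite -opprB mnorm1N.
  by apply: (ler_mnorm1_mderiv F F' (fun x => B * x) (fun=> B)) => // u /H;
     [exact: dF|exact: le].
Qed.

(** Near 0 the difference quotient lies within 1 of L. This is the base case of Taylor's formula. *)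
Lemma mderiv_lipschitz_at {m n} (F : R -> 'M[R[i]]_(m, n)) (t : R) L :
  mderiv F t L -> \forall h \near (0 : R),
    mnorm1 (F (t + h) - F t) <= (mnorm1 L + 1) * `|h|.
Proof.
move=> /cvg_cquotP /cvg_mnorm1P /cvgr0Pnorm_lt /(_ _ ltr01).
move=> /nbhs_ballP [d /= d0 hd]; near=> h.
have [->|h0] := eqVneq h 0; first by rewrite addr0 subrr mnorm10 normr0 mulr0.
have /= := hd h; rewrite ger0_norm ?mnorm1_ge0// => lt1.
have -> : F (t + h) - F t = h%:C *: cquot F t h.
  by rewrite /cquot scalerA -rmorphM/= divff// scale1r addrC [t + h]addrC addrC.
rewrite mnorm1Z mulrC ler_wpM2r//.
have -> : cquot F t h = L + - (L - cquot F t h) by rewrite opprB addrC subrK.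
rewrite (le_trans (ler_mnorm1D _ _))// mnorm1N lerD2l ltW// lt1//.
rewrite /ball /= sub0r normrN; near: h.
exact: near0_norm_lt.
Unshelve. all: by end_near. Qed.

Lemma is_derive_taylor_monomial (t u : R) k :
  is_derive u (1 : R) (fun v : R => (v - t) ^+ k.+1 / k.+1`!%:R)
    ((u - t) ^+ k / k`!%:R).
Proof.
rewrite (_ : (fun v : R => _) = k.+1`!%:R^-1 \*: ((id - cst t) ^+ k.+1)).
  apply: is_derive_eq; rewrite /GRing.scale /= !fctE subr0 mulr1.
  rewrite factS natrM invfM.
  have k0 : (k.+1%:R : R) != 0 by rewrite pnatr_eq0.
  by rewrite mulrACA mulVf// mul1r mulrC.
by apply/funext => v; rewrite /GRing.scale /= exprfctE mulrC.
Qed.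

(** The remainder of [F 0] differentiates to the remainder, one order lower, of the shifted family,
    so the mean value inequality gains one power of h at each induction step. *)
Lemma taylor_mnorm1 {p q} (n : nat) (F : nat -> R -> 'M[R[i]]_(p, q)) (t : R) L :
  (forall k, (k < n)%N -> forall u, mderiv (F k) u (F k.+1 u)) ->
  mderiv (F n) t L ->
  exists M : R, \forall h \near (0 : R),
    mnorm1 (F 0 (t + h) - \sum_(k < n.+1) (h ^+ k / k`!%:R)%:C *: F k t)
      <= M * `|h| ^+ n.+1.
Proof.
elim: n F => [|n IH] F dF dL.
  exists (mnorm1 L + 1); have := mderiv_lipschitz_at _ _ _ dL.
  by apply: filterS => h; rewrite big_ord1 expr0 fact0 divr1 scale1r expr1.
have [k kn|M /nbhs_ballP[d /= d0 hd]] := IH (fun k => F k.+1) _ dL.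
  exact: dF.
exists ((p * q)%:R * 2 * M); near=> h.
pose G u := F 0 u - \sum_(k < n.+2) ((u - t) ^+ k / k`!%:R)%:C *: F k t.
pose G' u := F 1 u - \sum_(k < n.+1) ((u - t) ^+ k / k`!%:R)%:C *: F k.+1 t.
have dG u : mderiv G u (G' u).
  apply: mderivD; first exact: dF.
  apply: mderivN; under eq_fun do rewrite big_ord_recl.
  rewrite -[X in mderiv _ _ X]add0r; apply: mderivD.
    by under eq_fun do rewrite expr0; exact: mderiv_cst.
  apply: mderiv_sum => k _; rewrite lift0.
  exact/mderiv_scale_cst/is_derive_taylor_monomial.
have Gt : G t = 0.
  rewrite /G big_ord_recl expr0 fact0 divr1 scale1r big1 ?addr0 ?subrr// => k _.
  by rewrite ?subrr lift0 expr0n mul0r scale0r.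
(* The sign of [M] is unknown. The bound at h itself, whose left side is a norm, gives this
   inequality, hence M >= 0 when h != 0; this is what allows |u - t| to be replaced by |h| below. *)
have M0 : 0 <= M * `|h| ^+ n.+1.
  have := hd h; rewrite /ball /= sub0r normrN => H.
  apply: le_trans (H _); first exact: mnorm1_ge0.
  by near: h; exact: near0_norm_lt.
have -> : F 0 (t + h) - \sum_(k < n.+2) (h ^+ k / k`!%:R)%:C *: F k t =
    G (t + h) - G t by rewrite Gt subr0 /G [t + h - t]addrAC subrr add0r.
have -> : (p * q)%:R * 2 * M * `|h| ^+ n.+2 =
    (p * q)%:R * 2 * (M * `|h| ^+ n.+1 * `|h|) by rewrite [_ ^+ n.+2]exprSr !mulrA.
apply: (ler_mnorm1_increment G G') => // u uth.
have := hd (u - t); rewrite /ball /= sub0r normrN => H.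
rewrite /G' -[in F 1 u](subrK t u) [_ - t + t]addrC.
apply: le_trans (H _) _.
  by rewrite (le_lt_trans uth)//; near: h; exact: near0_norm_lt.
have [h0|h0] := eqVneq h 0.
  by move: uth; rewrite h0 normr0 normr_le0 => /eqP ->; rewrite normr0.
rewrite ler_wpM2l ?lerXn2r ?nnegrE//.
by rewrite pmulr_lge0 // in M0; rewrite exprn_gt0// normr_gt0.
Unshelve. all: by end_near. Qed.

End MeanValue.

(** * Antiderivatives and global solutions of linear equations *)

Section Antiderivative.
Context {R : realType}.
Notation mu := (@lebesgue_measure R).

Definition primitive (f : R -> R) (t u : R) : R :=
  if t <= u then \int[mu]_(x in `[t, u]) f x else - \int[mu]_(x in `[u, t]) f x.

Lemma primitive_id (f : R -> R) t : primitive f t t = 0.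
Proof. by rewrite /primitive lexx set_itv1 Rintegral_set1. Qed.

(** A common lower end turns the oriented integral into a difference of ordinary integrals, to which
    the fundamental theorem with fixed lower end applies. *)
Lemma primitiveE (f : R -> R) (a t u : R) : continuous f -> a <= t -> a <= u ->
  primitive f t u = \int[mu]_(x in `[a, u]) f x - \int[mu]_(x in `[a, t]) f x.
Proof.
move=> cf at_ au.
have itf (b c : R) : mu.-integrable `[b, c] (EFin \o f).
  apply: continuous_compact_integrable; first exact: segment_compact.
  exact: continuous_subspaceT.
have itB (b c : R) : a <= b -> b <= c -> \int[mu]_(x in `[a, c]) f x -
    \int[mu]_(x in `[a, b]) f x = \int[mu]_(x in `[b, c]) f x.
  move=> ab bc; rewrite Rintegral_itvB ?bnd_simp//.
  rewrite Rintegral_itv_obnd_cbnd//.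
  by apply: integrableS (itf b c) => //; apply: subset_itvr; rewrite bnd_simp.
rewrite /primitive; case: ifPn => [tu|]; first by rewrite itB.
by rewrite -ltNge => /ltW ut; rewrite -(itB u t)// opprB.
Qed.

Lemma is_derive_primitive (f : R -> R) (t u : R) : continuous f ->
  is_derive u (1 : R) (primitive f t) (f u).
Proof.
(* Subtracting 1 puts [a] strictly below u, so that u is interior to the interval of integration. *)
move=> cf; pose a := Num.min t u - 1.
have au : a < u by rewrite /a ltrBlDr (@le_lt_trans _ _ u)// ?ltrDl// ge_min lexx orbT.
have at_ : a <= t by rewrite /a lerBlDr (@le_trans _ _ t)// ?lerDl// ge_min lexx.
pose F v := \int[mu]_(x in `[a, v]) f x.
have itf : mu.-integrable `[a, u + 1] (EFin \o f).
  apply: continuous_compact_integrable; first exact: segment_compact.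
  exact: continuous_subspaceT.
have uu1 : u < u + 1 by rewrite ltrDl.
have [dF F'] := continuous_FTC1_closed uu1 itf au (cf u).
apply: (@near_eq_is_derive _ _ _ (F - cst (F t))) => //.
  near=> v; rewrite fctE /= -/(F t) /cst /=.
  rewrite (primitiveE _ a)//; apply/ltW; near: v; exact: lt_nbhsr.
rewrite -[f u]subr0; apply: is_deriveB; split => //.
by rewrite -derive1E.
Unshelve. all: by end_near. Qed.

End Antiderivative.

(** * Matrix primitives and limits of geometrically convergent sequences *)

Section LinearODE.
Context {R : realType}.

Definition mcontinuous {m n} (F : R -> 'M[R[i]]_(m, n)) : Prop :=
  forall i j, continuous (fun u => complex.Re (F u i j) : R) /\
              continuous (fun u => complex.Im (F u i j) : R).

Definition mprimitive {m n} (F : R -> 'M[R[i]]_(m, n)) (t u : R) :=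
  \matrix_(i, j) (primitive (fun v => complex.Re (F v i j)) t u
               +i* primitive (fun v => complex.Im (F v i j)) t u).

Lemma mprimitive_id {m n} (F : R -> 'M[R[i]]_(m, n)) t : mprimitive F t t = 0.
Proof. by apply/matrixP => i j; rewrite !mxE !primitive_id. Qed.

Lemma mderiv_primitive {m n} (F : R -> 'M[R[i]]_(m, n)) t u :
  mcontinuous F -> mderiv (mprimitive F t) u (F u).
Proof.
move=> cF; split=> i j; under eq_fun do rewrite mxE /=;
  by apply: is_derive_primitive; have [] := cF i j.
Qed.

Lemma mderiv_mcontinuous {m n} (F F' : R -> 'M[R[i]]_(m, n)) :
  (forall u, mderiv F u (F' u)) -> mcontinuous F.
Proof.
move=> dF i j; split=> u; have [re im] := dF u.
- exact: is_derive_continuous (re i j).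
- exact: is_derive_continuous (im i j).
Qed.

Lemma mcontinuousM {m n p} (F : R -> 'M[R[i]]_(m, n)) (G : R -> 'M[R[i]]_(n, p)) :
  mcontinuous F -> mcontinuous G -> mcontinuous (fun u => F u *m G u).
Proof.
move=> cF cG i j; split.
- rewrite (_ : (fun u => _) = (fun u => \sum_k
    (complex.Re (F u i k) * complex.Re (G u k j) -
     complex.Im (F u i k) * complex.Im (G u k j)))); last first.
    by apply/funext => u; rewrite mxE Re_sum; apply: eq_bigr => k _; rewrite ReM.
  move=> u; apply: cvg_big => [|k _]; first exact: add_continuous.
  have [a b] := cF i k; have [c d] := cG k j.
  by apply: cvgB; apply: cvgM; [exact: a|exact: c|exact: b|exact: d].
- rewrite (_ : (fun u => _) = (fun u => \sum_k
    (complex.Re (F u i k) * complex.Im (G u k j) +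
     complex.Im (F u i k) * complex.Re (G u k j)))); last first.
    by apply/funext => u; rewrite mxE Im_sum; apply: eq_bigr => k _; rewrite ImM.
  move=> u; apply: cvg_big => [|k _]; first exact: add_continuous.
  have [a b] := cF i k; have [c d] := cG k j.
  by apply: cvgD; apply: cvgM; [exact: a|exact: d|exact: b|exact: c].
Qed.

Lemma continuous_mnorm1 {m n} (F : R -> 'M[R[i]]_(m, n)) :
  mcontinuous F -> continuous (fun u => mnorm1 (F u)).
Proof.
move=> cF u; apply: cvg_big => [|i _]; first exact: add_continuous.
apply: cvg_big => [|j _]; first exact: add_continuous.
have [a b] := cF i j.
by apply: cvgD; apply: cvg_norm; [exact: a|exact: b].
Qed.

(** The tail of the geometric series from k on is 2K 2^-k, so every a_k - 2K 2^-k lies below every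
    a_j + 2K 2^-j. The supremum of the former is the limit, and the rate comes with it. *)
Lemma geometric_increments_limit (a : nat -> R) (K : R) :
  (forall k, `|a k.+1 - a k| <= K * 2^-1 ^+ k) ->
  exists l, forall k, `|a k - l| <= 2 * K * 2^-1 ^+ k.
Proof.
move=> aK.
have K0 : 0 <= K by have := le_trans (normr_ge0 _) (aK 0%N); rewrite expr0 mulr1.
have dist k j : `|a (k + j)%N - a k| <= 2 * K * (2^-1 ^+ k - 2^-1 ^+ (k + j)).
  elim: j => [|j IH]; first by rewrite addn0 !subrr normr0 mulr0.
  have := aK (k + j)%N; rewrite addnS exprS; move: IH.
  move: (a _) (a _) (a _) (_ ^+ (k + j)) (_ ^+ k) => x y z p q.
  rewrite !ler_norml => /andP[h1 h2] /andP[h3 h4].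
  by apply/andP; split; lra.
have pos k : 0 <= K * 2^-1 ^+ k by rewrite mulr_ge0// exprn_ge0.
have cross k j : a k - 2 * K * 2^-1 ^+ k <= a j + 2 * K * 2^-1 ^+ j.
  have [kj|/ltnW jk] := leqP k j.
  - have := dist k (j - k)%N; rewrite subnKC// ler_norml => /andP[h1 h2].
    by have := pos j; have := pos k; nra.
  - have := dist j (k - j)%N; rewrite subnKC// ler_norml => /andP[h1 h2].
    by have := pos j; have := pos k; nra.
pose lo := [set a k - 2 * K * 2^-1 ^+ k | k in [set: nat]].
have lo0 : lo !=set0 by exists (a 0%N - 2 * K * 2^-1 ^+ 0); exists 0%N.
exists (sup lo) => k; rewrite ler_norml; apply/andP; split.
- rewrite lerBrDr addrC lerBlDr; apply: ge_sup => //.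
  by move=> _ [j _ <-]; exact: cross.
- rewrite lerBlDr addrC -lerBlDr; apply: ub_le_sup; last by exists k.
  by exists (a 0%N + 2 * K * 2^-1 ^+ 0) => _ [j _ <-]; exact: cross.
Qed.

Lemma geometric_increments_mlimit {m n} (A : nat -> 'M[R[i]]_(m, n)) (K : R) :
  (forall k, mnorm1 (A k.+1 - A k) <= K * 2^-1 ^+ k) ->
  exists L, forall k,
    mnorm1 (A k - L) <= (m * n)%:R * 2 * (2 * K * 2^-1 ^+ k).
Proof.
move=> AK.
have re i j : exists l, forall k, `|complex.Re (A k i j) - l| <= 2 * K * 2^-1 ^+ k.
  apply: geometric_increments_limit => k; apply: le_trans (AK k).
  by have := ler_Re_mnorm1 (A k.+1 - A k) i j; rewrite !mxE ReD ReN.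
have im i j : exists l, forall k, `|complex.Im (A k i j) - l| <= 2 * K * 2^-1 ^+ k.
  apply: geometric_increments_limit => k; apply: le_trans (AK k).
  by have := ler_Im_mnorm1 (A k.+1 - A k) i j; rewrite !mxE ImD ImN.
exists (\matrix_(i, j) (projT1 (cid (re i j)) +i* projT1 (cid (im i j)))) => k.
apply: mnorm1_le => i j.
- by rewrite !mxE ReD ReN /=; case: cid.
- by rewrite !mxE ImD ImN /=; case: cid.
Qed.

Lemma exists_geometric_lt (D e : R) : 0 < e -> exists k, D * 2^-1 ^+ k < e.
Proof.
move=> e0; have [D0|D0] := lerP D 0.
  by exists 0%N; rewrite expr0 mulr1 (le_lt_trans D0).
have : (geometric D 2^-1) @ \oo --> 0.
  by apply: cvg_geometric; rewrite ger0_norm ?invr_ge0// invf_lt1// ltr1n.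
move=> /cvgrPdist_lt /(_ _ e0) [k _ /(_ k (leqnn k))] /=.
rewrite sub0r normrN => h; exists k.
by rewrite (le_lt_trans (ler_norm _)).
Qed.

(** The error is weighted by E and need not be uniform on the line; continuity of E makes it uniform
    near each point, where E <= E u + 1, and the three-term estimate follows. *)
Lemma continuous_geometric_approx (f : R -> R) (s : nat -> R -> R) (E : R -> R) :
  (forall k, continuous (s k)) -> continuous E ->
  (forall k u, `|s k u - f u| <= E u * 2^-1 ^+ k) -> continuous f.
Proof.
move=> cs cE sf u; apply/cvgrPdist_lt => e e0.
have e3 : 0 < e / 3 by rewrite divr_gt0.
have [k hk] := exists_geometric_lt (E u + 1) _ e3.
have p0 : (0 : R) < 2^-1 ^+ k by rewrite exprn_gt0// invr_gt0.
near=> v.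
have hE : E v <= E u + 1.
  have : `|E u - E v| < 1.
    by near: v; move/cvgrPdist_lt: (cE u); exact.
  by rewrite ltr_norml => /andP[h1 h2]; lra.
have hs : `|s k u - s k v| < e / 3.
  by near: v; move/cvgrPdist_lt: (cs k u); exact.
have := sf k u; have := sf k v; move: hs.
have : E v * 2^-1 ^+ k <= (E u + 1) * 2^-1 ^+ k by rewrite ler_wpM2r// ltW.
have : E u * 2^-1 ^+ k <= (E u + 1) * 2^-1 ^+ k by rewrite ler_wpM2r ?ltW// ltrDl.
rewrite !ler_norml !ltr_norml => h1 h2 /andP[h3 h4] /andP[h5 h6] /andP[h7 h8].
by apply/andP; split; lra.
Unshelve. all: by end_near. Qed.

End LinearODE.

(** * Picard iteration in an exponentially weighted norm *)

Section GlobalExistence.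
Context {R : realType} {N p : nat}.
Context (Q : R -> 'M[R[i]]_N) (t : R) (cQ : mcontinuous Q).

(** The loss in the matrix mean value inequality, plus 1 for positivity. Building it into the weight
    makes the contraction ratio independent of the dimensions. *)
Let c : R := (N * p)%:R * 2 + 1.

Let c_gt0 : 0 < c.
Proof. by rewrite /c ltr_wpDl// mulr_ge0. Qed.

Let w : R -> R := primitive (fun u => c * mnorm1 (Q u)) t.

Let dw u : is_derive u (1 : R) w (c * mnorm1 (Q u)).
Proof.
apply: is_derive_primitive => v.
by apply: cvgM; [exact: cvg_cst|exact: continuous_mnorm1].
Qed.

Let w_ndecr a b : a <= b -> w a <= w b.
Proof.
move=> ab; rewrite -subr_ge0 (@le_trans _ _ `|cst 0 b - cst 0 a : R|)//.
apply: (ler_dist_derive _ _ (fun=> 0) (fun u => c * mnorm1 (Q u))) => // u _.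
by rewrite normr0 mulr_ge0 ?mnorm1_ge0// ltW.
Qed.

Let w_t : w t = 0. Proof. exact: primitive_id. Qed.

Let weight u := expR (2 * `|w u|).

(* The weight exp (2 |w|), with w' = c |Q|, makes the Picard operator a
   contraction of ratio 1/2 on the whole line. *)
Lemma picard_contraction (F G : R -> 'M[R[i]]_(N, p)) (A : R) :
  (forall u, mderiv F u (Q u *m G u)) -> F t = 0 ->
  (forall u, mnorm1 (G u) <= A * weight u) ->
  forall u, mnorm1 (F u) <= A / 2 * weight u.
Proof.
move=> dF F0 GA u.
have A0 : 0 <= A.
  have := le_trans (mnorm1_ge0 _) (GA t).
  by rewrite /weight w_t normr0 mulr0 expR0 mulr1.
(* Here s is 1 to the right of t and -1 to the left, so that |w| = s w; the function is then a
   primitive of the bound A |Q| exp(2|w|). *)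
have dg (s v : R) : is_derive v (1 : R)
    (fun x => s * (A / (2 * c)) * expR (2 * (s * w x)))
    (s ^+ 2 * (A * mnorm1 (Q v) * expR (2 * (s * w v)))).
  rewrite (_ : (fun _ => _) =
      (s * (A / (2 * c))) \*: (expR \o ((2 * s) \*: w))); last first.
    by apply/funext => x; rewrite /GRing.scale /= [2 * (s * _)]mulrA.
  have dsw := dw v.
  have := is_derive1_comp (is_derive_expR (((2 * s) \*: w) v))
    (is_deriveZ (2 * s) dsw).
  move=> /(is_deriveZ (s * (A / (2 * c)))) /is_derive_eq; apply.
  rewrite /GRing.scale /= mulrA.
  rewrite -[_ *: w v]/(2 * s * w v) [2 * s * w v](_ : _ = 2 * (s * w v)) ?mulrA//.
  by field; rewrite gt_eqF.
have le s v : s ^+ 2 = 1 -> `|w v| = s * w v ->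
    mnorm1 (Q v *m G v) <= s ^+ 2 * (A * mnorm1 (Q v) * expR (2 * (s * w v))).
  move=> s1 wv; rewrite (le_trans (ler_mnorm1M _ _))// s1 mul1r.
  by rewrite [A * _]mulrC -mulrA ler_wpM2l ?mnorm1_ge0// -wv; exact: GA.
(* The factor [(N * p)%:R * 2] is at most [c] and cancels the [c] of the majorant, leaving the ratio
   1/2. *)
have fin (D : R) : D = A / (2 * c) * (expR (2 * `|w u|) - 1) ->
    (N * p)%:R * 2 * D <= A / 2 * weight u.
  move=> ->; have e1 : 1 <= expR (2 * `|w u|) by rewrite -expR0 ler_expR mulr_ge0.
  have D0 : 0 <= A / (2 * c) * (expR (2 * `|w u|) - 1).
    by rewrite mulr_ge0 ?subr_ge0// divr_ge0// mulr_ge0// ltW.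
  apply: (@le_trans _ _ (c * (A / (2 * c) * (expR (2 * `|w u|) - 1)))).
    by rewrite ler_wpM2r// lerDl.
  rewrite (_ : c * _ = A / 2 * (expR (2 * `|w u|) - 1)); last first.
    by field; rewrite gt_eqF.
  by rewrite ler_wpM2l ?divr_ge0// gerBl.
have [tu|/ltW ut] := leP t u.
- rewrite -[F u]subr0 -F0.
  have wE v : t <= v -> `|w v| = 1 * w v.
    by move=> tv; rewrite mul1r ger0_norm// -w_t w_ndecr.
  apply: le_trans (ler_mnorm1_mderiv _ _ _ _ _ _ tu (fun v _ => dF v)
    (fun v _ => dg 1 v) _) _.
    by move=> v /andP[tv _]; apply: le; [rewrite expr1n|exact: wE].
  by apply: fin; rewrite w_t mulr0 mulr0 expR0 -wE// mul1r mulrBr mulr1.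
- rewrite -[F u]subr0 -F0 -mnorm1N opprB.
  have wE v : v <= t -> `|w v| = -1 * w v.
    by move=> tv; rewrite mulN1r ler0_norm// -w_t w_ndecr.
  apply: le_trans (ler_mnorm1_mderiv _ _ _ _ _ _ ut (fun v _ => dF v)
    (fun v _ => dg (-1) v) _) _.
    by move=> v /andP[_ tv]; apply: le; [rewrite sqrrN expr1n|exact: wE].
  by apply: fin; rewrite w_t mulr0 mulr0 expR0 -wE// mulr1 mulN1r; ring.
Qed.

Lemma linear_ode_exists (X0 : 'M[R[i]]_(N, p)) :
  exists X : R -> 'M[R[i]]_(N, p),
    X t = X0 /\ forall u, mderiv X u (Q u *m X u).
Proof.
(* By linearity the differences of successive Picard iterates are themselves iterated integrals:
   [phi] lists these terms, and [S] below their partial sums. *)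
pose fix phi k : R -> 'M[R[i]]_(N, p) :=
  if k is j.+1 then mprimitive (fun v => Q v *m phi j v) t else fun=> X0.
have cphi k : mcontinuous (phi k).
  case: k => [|k]; first by apply: mderiv_mcontinuous => u; exact: mderiv_cst.
  elim: k => [|k IH]; apply: mderiv_mcontinuous => u;
    apply: mderiv_primitive; apply: mcontinuousM => //.
  by apply: mderiv_mcontinuous => v; exact: mderiv_cst.
have dphi k u : mderiv (phi k.+1) u (Q u *m phi k u).
  by apply: mderiv_primitive; exact: mcontinuousM.
have bphi k u : mnorm1 (phi k u) <= mnorm1 X0 * 2^-1 ^+ k * weight u.
  elim: k u => [|k IH] u.
    rewrite expr0 mulr1 ler_peMr ?mnorm1_ge0// -expR0 ler_expR mulr_ge0//.
  rewrite exprSr mulrA.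
  apply: (picard_contraction (phi k.+1) (phi k)) => //; exact: mprimitive_id.
pose S k u := \sum_(j < k) phi j u.
have SD k u : S k.+1 u - S k u = phi k u.
  by rewrite /S big_ord_recr /= addrAC subrr add0r.
have limS u : exists L, forall k, mnorm1 (S k u - L) <=
    (N * p)%:R * 2 * (2 * (mnorm1 X0 * weight u) * 2^-1 ^+ k).
  apply: (geometric_increments_mlimit (fun k => S k u)) => k.
  by rewrite SD mulrAC.
have /choice [X hX] := limS.
pose D := (N * p)%:R * 2 * (2 * mnorm1 X0).
have hX' k u : mnorm1 (S k u - X u) <= D * 2^-1 ^+ k * weight u.
  by apply: le_trans (hX u k) _; rewrite le_eqVlt /D; apply/orP; left;
     apply/eqP; ring.
have cS k : mcontinuous (S k).
  apply: (@mderiv_mcontinuous _ _ _ _ (fun u => \sum_(j < k)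
    if j == 0%N :> nat then 0 else Q u *m phi j.-1 u)) => u.
  apply: mderiv_sum => j _; case: (nat_of_ord j) => [|a] /=; first exact: mderiv_cst.
  exact: dphi.
have cweight : continuous (fun u => D * weight u).
  move=> u; apply: cvgM; first exact: cvg_cst.
  apply: continuous_comp; last exact: continuous_expR.
  apply: cvgM; first exact: cvg_cst.
  by apply: cvg_norm; exact: is_derive_continuous (dw u).
have cX : mcontinuous X.
  move=> i j; split.
  - apply: (continuous_geometric_approx _ (fun k u => complex.Re (S k u i j))
      (fun u => D * weight u)) => // [k|k u]; first by have [] := cS k i j.
    rewrite mulrAC; apply: le_trans (hX' k u).
    by have := ler_Re_mnorm1 (S k u - X u) i j; rewrite !mxE ReD ReN.
  - apply: (continuous_geometric_approx _ (fun k u => complex.Im (S k u i j))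
      (fun u => D * weight u)) => // [k|k u]; first by have [] := cS k i j.
    rewrite mulrAC; apply: le_trans (hX' k u).
    by have := ler_Im_mnorm1 (S k u - X u) i j; rewrite !mxE ImD ImN.
(* The limit X is so far only continuous; it becomes differentiable by being shown equal to its own
   Picard image Y. *)
pose Y u := X0 + mprimitive (fun v => Q v *m X v) t u.
have dY u : mderiv Y u (Q u *m X u).
  rewrite -[X in mderiv _ _ X]add0r; apply: mderivD; first exact: mderiv_cst.
  by apply: mderiv_primitive; exact: mcontinuousM.
have YX u : Y u = X u.
  apply/eqP; rewrite -subr_eq0; apply/eqP/mnorm1_eq0; apply/ler_addgt0Pr => e e0.
  have [k hk] := exists_geometric_lt (D * weight u) _ e0.
  (* Y - S (k+1) vanishes at t and has derivative Q (X - S k), so the contraction makes it as small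
     as the error of S k. *)
  have dYS v : mderiv (fun v => Y v - S k.+1 v) v (Q v *m (X v - S k v)).
    rewrite mulmxBr; apply: mderivD => //; apply: mderivN.
    rewrite /S; under eq_fun do rewrite big_ord_recl.
    rewrite -[X in mderiv _ _ X]add0r mulmx_sumr.
    apply: mderivD; first exact: mderiv_cst.
    by apply: mderiv_sum => j _; rewrite lift0; exact: dphi.
  have Yt : Y t - S k.+1 t = 0.
    rewrite /Y mprimitive_id addr0 /S big_ord_recl big1 ?addr0 ?subrr// => j _.
    by rewrite lift0; exact: mprimitive_id.
  have := picard_contraction _ _ (D * 2^-1 ^+ k) dYS Yt.
  have bXS v : mnorm1 (X v - S k v) <= D * 2^-1 ^+ k * weight v.
    by rewrite -mnorm1N opprB.
  move=> /(_ bXS u) b1; have b2 := hX' k.+1 u.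
  rewrite add0r -[Y u](subrK (S k.+1 u)) -addrA (le_trans (ler_mnorm1D _ _))//.
  apply: le_trans (lerD b1 b2) _; rewrite exprSr.
  by rewrite mulrAC in hk; lra.
exists X; split; first by rewrite -YX /Y mprimitive_id addr0.
by move=> u; have XY : X = Y by [apply/funext => v; rewrite YX]; rewrite [X in mderiv X]XY.
Qed.

End GlobalExistence.

(** * Landau symbols at 0+ *)

Section RightBigO.
Context {R : realType}.

(** A real constant and a submultiplicative real norm let error terms be multiplied; to the right of
    0 the gauge needs no absolute value. *)
Definition bigO0 {m n} (k : nat) (F : R -> 'M[R[i]]_(m, n)) : Prop :=
  exists M : R, \forall tau \near 0^'+, mnorm1 (F tau) <= M * tau ^+ k.

Lemma eqaddO_bigO0 {m n} (k : nat) (f g : R -> 'M[R[i]]_(m, n)) :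
  f = g +O_ (0^'+) (powC k) <-> bigO0 k (fun tau => f tau - g tau).
Proof.
have normP (tau : R) : 0 < tau -> `|powC k tau| = (tau ^+ k)%:C.
  by move=> t0; rewrite normc_def /= expr0n addr0 sqrtr_sqr ger0_norm// exprn_ge0// ltW.
split=> [/eqaddOP [M [Mr hM]]|[M hM]].
- have M1 : M < M + 1 by rewrite ltrDl.
  exists ((m * n)%:R * 2 * (2 * complex.Re (M + 1))).
  have := hM _ M1; apply: filterS2 (nbhs_right_gt 0) => tau t0.
  rewrite normP// => le; rewrite (le_trans (ler_mnorm1_norm _))//.
  rewrite -!mulrA !ler_wpM2l//.
  move: le; rewrite lecE => /andP[_]; rewrite ReM /= mulr0 subr0.
  by apply: le_trans.
- apply/eqaddOP; near=> K.
  move: hM; apply: filterS2 (nbhs_right_gt 0) => tau t0 le.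
  rewrite normP// (le_trans (ler_norm_mnorm1 _))//.
  apply: (@le_trans _ _ (M * tau ^+ k)%:C); first by rewrite lecR.
  rewrite rmorphM/= ler_wpM2r ?ler0c ?exprn_ge0 ?ltW//.
  by near: K; apply: nbhs_pinfty_gt; rewrite complex_real.
Unshelve. all: by end_near. Qed.

Lemma bigO0_ext {m n} k (F G : R -> 'M[R[i]]_(m, n)) :
  bigO0 k F -> F =1 G -> bigO0 k G.
Proof. by move=> ? /funext <-. Qed.

Lemma bigO0D {m n} k (F G : R -> 'M[R[i]]_(m, n)) :
  bigO0 k F -> bigO0 k G -> bigO0 k (fun tau => F tau + G tau).
Proof.
move=> [M hM] [K hK]; exists (M + K); apply: filterS2 hM hK => tau h1 h2.
by rewrite (le_trans (ler_mnorm1D _ _))// mulrDl lerD.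
Qed.

Lemma bigO0N {m n} k (F : R -> 'M[R[i]]_(m, n)) :
  bigO0 k F -> bigO0 k (fun tau => - F tau).
Proof.
by move=> [M hM]; exists M; apply: filterS hM => tau; rewrite mnorm1N.
Qed.

Lemma bigO0M {m n p} j k (F : R -> 'M[R[i]]_(m, n)) (G : R -> 'M[R[i]]_(n, p)) :
  bigO0 j F -> bigO0 k G -> bigO0 (j + k) (fun tau => F tau *m G tau).
Proof.
move=> [M hM] [K hK]; exists (M * K); apply: filterS2 hM hK => tau h1 h2.
rewrite (le_trans (ler_mnorm1M _ _))// exprD mulrACA.
by rewrite ler_pM// mnorm1_ge0.
Qed.

Lemma bigO0_cst {m n} (A : 'M[R[i]]_(m, n)) : bigO0 0 (fun=> A).
Proof.
by exists (mnorm1 A); apply: nearW => tau; rewrite expr0 mulr1.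
Qed.

Lemma bigO0_sum {m n} k (I : Type) (r : seq I) (P : pred I)
    (F : I -> R -> 'M[R[i]]_(m, n)) :
  (forall i, P i -> bigO0 k (F i)) ->
  bigO0 k (fun tau => \sum_(i <- r | P i) F i tau).
Proof.
move=> FO; elim: r => [|i r IH].
  under eq_fun do rewrite big_nil.
  by exists 0; apply: nearW => tau; rewrite mnorm10 mul0r.
under eq_fun do rewrite big_cons.
case: (P i) (FO i) => // FOi; apply: bigO0D => //; exact: FOi.
Qed.

Lemma bigO0Z {m n} j k (F : R -> 'M[R[i]]_(m, n)) :
  bigO0 k F -> bigO0 (j + k) (fun tau => (tau ^+ j)%:C *: F tau).
Proof.
move=> [M hM]; exists M; apply: filterS2 (nbhs_right_gt 0) hM => tau t0 h.
have tj : 0 <= tau ^+ j by rewrite exprn_ge0// ltW.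
by rewrite mnorm1Z exprD mulrCA ger0_norm// ler_wpM2l.
Qed.

Lemma bigO0_le {m n} j k (F : R -> 'M[R[i]]_(m, n)) :
  (j <= k)%N -> bigO0 k F -> bigO0 j F.
Proof.
move=> jk [M hM]; exists M.
apply: filterS3 (nbhs_right_gt 0) (nbhs_right_lt ltr01) hM => tau t0 t1 h.
rewrite (le_trans h)// -(subnKC jk) exprD mulrA ler_piMr//; last first.
  by rewrite exprn_ile1// ltW.
have := le_trans (mnorm1_ge0 _) h.
by rewrite pmulr_lge0 ?exprn_gt0// => M0; rewrite mulr_ge0// exprn_ge0// ltW.
Qed.

Lemma bigO0_poly {m n} d (A : nat -> 'M[R[i]]_(m, n)) :
  bigO0 0 (fun tau => \sum_(k < d) (tau ^+ k)%:C *: A k).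
Proof.
apply: bigO0_sum => k _; apply: (bigO0_le _ (k + 0)) => //.
exact/bigO0Z/bigO0_cst.
Qed.

(** Induction splits off A_0: what remains is tau times the same difference for the shifted sequence
    A_(k+1), minus one term with the factor tau^(d+1) coming from B_d. *)
Lemma bigO0_cauchy_product {m n p} d (A : nat -> 'M[R[i]]_(m, n))
    (B : nat -> 'M[R[i]]_(n, p)) (C : nat -> 'M[R[i]]_(m, p)) :
  (forall k, (k < d)%N -> C k = \sum_(j < k.+1) A j *m B (k - j)%N) ->
  bigO0 d (fun tau => \sum_(k < d) (tau ^+ k)%:C *: C k -
    (\sum_(k < d) (tau ^+ k)%:C *: A k) *m (\sum_(k < d) (tau ^+ k)%:C *: B k)).
Proof.
elim: d A C => [|d IH] A C hC.
  apply: (bigO0_ext _ (fun=> 0)); first exact: bigO0_cst.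
  by move=> tau; rewrite !big_ord0 mul0mx subr0.
pose C' k := \sum_(j < k.+1) A j.+1 *m B (k - j)%N.
have O1 := bigO0Z 1 _ _ (IH (fun k => A k.+1) C' (fun k _ => erefl)).
have O2 : bigO0 d.+1 (fun tau => (tau ^+ d.+1)%:C *:
    ((\sum_(k < d) (tau ^+ k)%:C *: A k.+1) *m B d)).
  rewrite -[X in bigO0 X]addn0; apply: bigO0Z.
  by apply: (bigO0M 0 0); [exact: (bigO0_poly d (fun k => A k.+1))|exact: bigO0_cst].
apply: bigO0_ext (bigO0D _ _ _ O1 (bigO0N _ _ O2)) _ => tau /=.
rewrite [\sum_(k < d.+1) _ *: A k]big_ord_recl expr0 scale1r mulmxDl.
have E1 : \sum_(k < d.+1) (tau ^+ k)%:C *: C k =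
    A 0%N *m (\sum_(k < d.+1) (tau ^+ k)%:C *: B k) +
    tau%:C *: \sum_(k < d) (tau ^+ k)%:C *: C' k.
  rewrite mulmx_sumr [LHS]big_ord_recl [in RHS]big_ord_recl !expr0 !scale1r.
  rewrite -!addrA hC// big_ord1 subn0 scaler_sumr -big_split; congr (_ + _).
  apply: eq_bigr => k _; rewrite lift0 hC ?ltnS// big_ord_recl subn0.
  rewrite scalerDr -scalemxAr scalerA -rmorphM/= -exprS; congr (_ + _ *: _).
have E2 : \sum_(j < d) (tau ^+ lift ord0 j)%:C *: A (lift ord0 j) =
    tau%:C *: \sum_(k < d) (tau ^+ k)%:C *: A k.+1.
  rewrite scaler_sumr; apply: eq_bigr => j _.
  by rewrite lift0 scalerA -rmorphM/= -exprS.
rewrite E1 E2 opprD addrACA subrr add0r expr1 scalerBr -addrA; congr (_ + _).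
rewrite -opprD -scalemxAl exprS rmorphM/= -scalerA -scalerDr; congr (- (_ *: _)).
by rewrite [in RHS]big_ord_recr/= mulmxDr -scalemxAr.
Qed.

(** Write D = D Y - D (Y - 1). Once |Y - 1| <= 1/2, the last term is absorbed into the left side,
    whence the constant 2M; Y is never inverted. *)
Lemma bigO0_mulmx_cancel {m n} k (D : R -> 'M[R[i]]_(m, n)) (Y : R -> 'M[R[i]]_n) :
  bigO0 k (fun tau => D tau *m Y tau) -> bigO0 1 (fun tau => Y tau - 1%:M) ->
  bigO0 k D.
Proof.
move=> [M hM] [K hK]; exists (2 * M).
have d0 : 0 < (2 * (`|K| + 1))^-1 by rewrite invr_gt0 mulr_gt0// ltr_wpDl.
apply: filterS2 (nbhs_right_gt 0) _; last first.
  apply: filterS3 (nbhs_right_lt d0) hM hK => tau t1 h1 h2.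
  exact: (conj t1 (conj h1 h2)).
move=> tau t0 [t1 [h1 h2]].
have Y2 : mnorm1 (Y tau - 1%:M) <= 2^-1.
  rewrite (le_trans h2)// expr1 (@le_trans _ _ ((`|K| + 1) * tau))//.
    by rewrite ler_wpM2r ?ltW// (le_lt_trans (ler_norm _))// ltrDl.
  have K1 : 0 < `|K| + 1 by rewrite ltr_wpDl.
  by rewrite mulrC -ler_pdivlMr// -invfM ltW.
have -> : D tau = D tau *m Y tau - D tau *m (Y tau - 1%:M).
  by rewrite -mulmxBr opprB addrC subrK mulmx1.
have := ler_mnorm1D (D tau *m Y tau) (- (D tau *m (Y tau - 1%:M))).
rewrite mnorm1N => h3; have := ler_mnorm1M (D tau) (Y tau - 1%:M) => h4.
have h5 : mnorm1 (D tau) * mnorm1 (Y tau - 1%:M) <= mnorm1 (D tau) * 2^-1.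
  by rewrite ler_wpM2l ?mnorm1_ge0.
move: h3; rewrite {1 2}(_ : D tau *m Y tau - D tau *m (Y tau - 1%:M) = D tau).
  by lra.
by rewrite -mulmxBr opprB addrC subrK mulmx1.
Qed.

(** Transfers to the matrix X what the scheme asserts of vector solutions: F is the sum of its
    columns times unit rows. *)
Lemma bigO0_col {m n} k (F : R -> 'M[R[i]]_(m, n)) :
  (forall j, bigO0 k (fun tau => col j (F tau))) -> bigO0 k F.
Proof.
move=> FO; apply: (bigO0_ext _
    (fun tau => \sum_j col j (F tau) *m (delta_mx 0 j : 'rV[R[i]]_n))).
  apply: bigO0_sum => j _; rewrite -[k]addn0.
  by apply: bigO0M; [exact: FO|exact: bigO0_cst].
move=> tau; apply/matrixP => i j; rewrite summxE (bigD1 j)//= big1 => [|l lj].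
  by rewrite !mxE big_ord1 !mxE !eqxx mulr1 addr0.
by rewrite !mxE big_ord1 !mxE [j == l]eq_sym (negPf lj) andbF mulr0.
Qed.

Lemma near0_scale_right (P : R -> Prop) (a : R) :
  (\forall h \near (0 : R), P h) -> \forall tau \near 0^'+, P (a * tau).
Proof.
move=> /nbhs_ballP [d /= d0 hd].
have a0 : 0 < `|a| + 1 by rewrite ltr_wpDl.
apply: filterS2 (nbhs_right_gt 0) (nbhs_right_lt (divr_gt0 d0 a0)) => tau t0 t1.
apply: hd; rewrite /ball /= sub0r normrN normrM (gtr0_norm t0).
rewrite (@le_lt_trans _ _ ((`|a| + 1) * tau))//; first by rewrite ler_wpM2r ?ltW// ltrDl.
by rewrite mulrC -ltr_pdivlMr.
Qed.

Lemma taylor_bigO0 {p q} (n : nat) (F : nat -> R -> 'M[R[i]]_(p, q)) (t a : R) L :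
  (forall k, (k < n)%N -> forall u, mderiv (F k) u (F k.+1 u)) ->
  mderiv (F n) t L ->
  bigO0 n.+1 (fun tau => F 0%N (t + a * tau) -
    \sum_(k < n.+1) (tau ^+ k)%:C *: ((a ^+ k / k`!%:R)%:C *: F k t)).
Proof.
move=> dF dL; have [M hM] := taylor_mnorm1 n F t L dF dL.
exists (M * `|a| ^+ n.+1).
have := near0_scale_right _ a hM; apply: filterS2 (nbhs_right_gt 0) => tau t0.
rewrite normrM (gtr0_norm t0) exprMn mulrA.
congr (mnorm1 (_ - _) <= _); apply: eq_bigr => k _.
by rewrite scalerA -rmorphM/= exprMn mulrCA mulrA.
Qed.

End RightBigO.

(** * The expansion of the solutions and of the scheme *)

(* Noncommutative ring identities: expand both sides into monomials, then
   compare entries, in which the monomials occur linearly. *)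
Ltac mx_noncomm_ring :=
  rewrite ?(mulmxDl, mulmxDr, mulmxBl, mulmxBr, mulNmx, mulmxN, mulmxA,
            mulmx1, mul1mx, mulmx0, mul0mx);
  rewrite -?(scalemxAl, scalemxAr) ?mulmxA;
  repeat match goal with
    |- context [mulmx ?a ?b] => move: (mulmx a b) => ?
  end;
  let i := fresh "i" in let j := fresh "j" in
  apply/matrixP => i j; rewrite !mxE.

Section EvolutionCoefficients.
Context {R : realType} {N : nat}.
Context (Q : nat -> R -> 'M[R[i]]_N).

(* x^(k) = evolution_coef k x along every solution x of x' = Q x, where Q k
   is the k-th derivative of Q. *)
Definition evolution_coef (k : nat) (u : R) : 'M[R[i]]_N :=
  let Q0 := Q 0 u in
  let Q1 := Q 1 u in
  let Q2 := Q 2 u in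
  let Q3 := Q 3 u in
  match k with
  | 0 => 1%:M
  | 1 => Q0
  | 2 => Q1 + Q0 *m Q0
  | 3 => Q2 + 2%:R *: (Q1 *m Q0) + Q0 *m Q1 + Q0 *m Q0 *m Q0
  | _ => Q3 + 3%:R *: (Q2 *m Q0) + Q0 *m Q2 + 3%:R *: (Q1 *m Q1)
         + 3%:R *: (Q1 *m Q0 *m Q0) + 2%:R *: (Q0 *m Q1 *m Q0)
         + Q0 *m Q0 *m Q1 + Q0 *m Q0 *m Q0 *m Q0
  end.

Context (dQ : forall k, (k < 4)%N -> forall u, mderiv (Q k) u (Q k.+1 u)).

Let dQ0 u : mderiv (Q 0) u (Q 1 u). Proof. exact: dQ. Qed.
Let dQ1 u : mderiv (Q 1) u (Q 2 u). Proof. exact: dQ. Qed.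
Let dQ2 u : mderiv (Q 2) u (Q 3 u). Proof. exact: dQ. Qed.
Let dQ3 u : mderiv (Q 3) u (Q 4 u). Proof. exact: dQ. Qed.

Ltac solve_mderiv :=
  lazymatch goal with
  | |- mderiv (fun u => _ + _) _ _ => apply: mderivD; solve_mderiv
  | |- mderiv (fun u => _ *: _) _ _ => apply: mderivZ; solve_mderiv
  | |- mderiv (fun u => _ *m _) _ _ => apply: mderivM; solve_mderiv
  | |- _ => first [exact: dQ0 | exact: dQ1 | exact: dQ2 | exact: dQ3]
  end.

Lemma mderiv_evolution_coef k u : (k < 4)%N ->
  mderiv (evolution_coef k) u
    (evolution_coef k.+1 u - evolution_coef k u *m Q 0 u).
Proof.
case: k => [|[|[|[|//]]]] _ /=; rewrite /evolution_coef /=.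
- by rewrite mul1mx subrr; exact: mderiv_cst.
- by rewrite addrK.
- apply: mderiv_eq; first by solve_mderiv.
  by mx_noncomm_ring; ring.
- apply: mderiv_eq; first by solve_mderiv.
  by mx_noncomm_ring; ring.
Qed.

(** G_4 contains the third derivative of Q, so the fourth one enters here; this brings the Taylor
    remainder to order 5. *)
Lemma mderiv_evolution_coef4 u : exists L, mderiv (evolution_coef 4) u L.
Proof. by eexists; rewrite /evolution_coef /=; solve_mderiv. Qed.

(** [F k] is the k-th derivative of X: the term G_k Q X of the product rule cancels the correction
    in the derivative of G_k. A general [p] covers both vector solutions and the matrix X. *)
Lemma solution_taylor {p} (X : R -> 'M[R[i]]_(N, p)) (t a : R) :
  (forall u, mderiv X u (Q 0 u *m X u)) ->
  bigO0 5 (fun tau => X (t + a * tau) -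
    (\sum_(k < 5) (tau ^+ k)%:C *: ((a ^+ k / k`!%:R)%:C *: evolution_coef k t))
      *m X t).
Proof.
move=> dX; pose F k u := evolution_coef k u *m X u.
have dF k : (k < 4)%N -> forall u, mderiv (F k) u (F k.+1 u).
  move=> k4 u; apply: mderiv_eq.
    by apply: mderivM; [exact: mderiv_evolution_coef|exact: dX].
  by rewrite /F mulmxBl mulmxA subrK.
have [L4 dL4] := mderiv_evolution_coef4 t.
have dF4 := mderivM _ _ _ _ _ dL4 (dX t).
apply: bigO0_ext (taylor_bigO0 4 F t a _ dF dF4) _ => tau.
rewrite mulmx_suml; congr (_ - _); first by rewrite /F /= mul1mx.
by apply: eq_bigr => k _; rewrite !scalemxAl.
Qed.

End EvolutionCoefficients.

(* The coefficients of tau, ..., tau^4 in x(t + s tau) = T x(t + (s - 1) tau). *)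
Lemma order_conditions {R : realType} {N : nat} (s sb : R)
    (Q Q2 Q3 Q4 T2 T3 T4 : 'M[R[i]]_N) :
  sb = s - 1 ->
  T2 = ((2 * s - 1) / 2`!%:R)%:C *: Q2 - sb%:C *: (Q *m Q) ->
  T3 = ((3 * s ^+ 2 - 3 * s + 1) / 3`!%:R)%:C *: Q3
       - (sb ^+ 2 / 2`!%:R)%:C *: (Q *m Q2)
       - ((2 * s - 1) * sb / 2`!%:R)%:C *: (Q2 *m Q)
       + (sb ^+ 2)%:C *: (Q *m (Q *m Q)) ->
  T4 = ((2 * s - 1) * (2 * s ^+ 2 - 2 * s + 1) / 4`!%:R)%:C *: Q4
       - (sb ^+ 3 / 3`!%:R)%:C *: (Q *m Q3)
       - (sb ^+ 2 / 2`!%:R)%:C *: (T2 *m Q2)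
       - sb%:C *: (T3 *m Q) ->
  [/\ s%:C *: Q = Q + sb%:C *: Q,
      (s ^+ 2 / 2`!%:R)%:C *: Q2 =
        T2 + sb%:C *: (Q *m Q) + (sb ^+ 2 / 2`!%:R)%:C *: Q2,
      (s ^+ 3 / 3`!%:R)%:C *: Q3 =
        T3 + sb%:C *: (T2 *m Q) + (sb ^+ 2 / 2`!%:R)%:C *: (Q *m Q2)
        + (sb ^+ 3 / 3`!%:R)%:C *: Q3 &
      (s ^+ 4 / 4`!%:R)%:C *: Q4 =
        T4 + sb%:C *: (T3 *m Q) + (sb ^+ 2 / 2`!%:R)%:C *: (T2 *m Q2)
        + (sb ^+ 3 / 3`!%:R)%:C *: (Q *m Q3) + (sb ^+ 4 / 4`!%:R)%:C *: Q4].
Proof.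
have f2 : 2`!%:R = 2 :> R by [].
have f3 : 3`!%:R = 6 :> R by [].
have f4 : 4`!%:R = 24 :> R by [].
(* The scalar coefficients of the T_k are (s^k - sb^k)/k!, since s^2 - sb^2 = 2s - 1, s^3 - sb^3 =
   3s^2 - 3s + 1 and s^4 - sb^4 = (2s - 1)(2s^2 - 2s + 1). *)
rewrite f2 f3 f4 => -> T2E T3E T4E; split.
- by mx_noncomm_ring; ring.
- by rewrite T2E; mx_noncomm_ring; field.
(* T_3 is given with T_2 Q already expanded, so T_2 is unfolded too; in T_4 the matrices T_2 and T_3
   remain atoms. *)
- by rewrite T3E T2E; mx_noncomm_ring; field.
- by rewrite T4E; mx_noncomm_ring; field.
Qed.

Lemma approximates_order4P {R : realType} {N : nat} (Q : nat -> R -> 'M[R[i]]_N)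
    (t s : R) (T : R -> 'M[R[i]]_N) (T2 T3 T4 : 'M[R[i]]_N) :
  (forall k, (k < 4)%N -> forall u, mderiv (Q k) u (Q k.+1 u)) ->
  let G k := evolution_coef Q k t in
  let sb := s - 1 in
  T2 = ((2 * s - 1) / 2`!%:R)%:C *: G 2 - sb%:C *: (G 1 *m G 1) ->
  T3 = ((3 * s ^+ 2 - 3 * s + 1) / 3`!%:R)%:C *: G 3
       - (sb ^+ 2 / 2`!%:R)%:C *: (G 1 *m G 2)
       - ((2 * s - 1) * sb / 2`!%:R)%:C *: (G 2 *m G 1)
       + (sb ^+ 2)%:C *: (G 1 *m (G 1 *m G 1)) ->
  T4 = ((2 * s - 1) * (2 * s ^+ 2 - 2 * s + 1) / 4`!%:R)%:C *: G 4
       - (sb ^+ 3 / 3`!%:R)%:C *: (G 1 *m G 3)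
       - (sb ^+ 2 / 2`!%:R)%:C *: (T2 *m G 2)
       - sb%:C *: (T3 *m G 1) ->
  approximates_with_order 4 (Q 0) t s T <->
  T = (fun tau : R => 1%:M + tau%:C *: G 1 + (tau ^+ 2)%:C *: T2
                      + (tau ^+ 3)%:C *: T3 + (tau ^+ 4)%:C *: T4)
      +O_ (0^'+) (powC 5).
Proof.
move=> dQ G sb T2E T3E T4E.
have dQ0 : forall u, mderiv (Q 0) u (Q 1 u) := dQ 0 isT.
have taylor p (X : R -> 'M[R[i]]_(N, p)) : (forall u, mderiv X u (Q 0 u *m X u)) ->
    forall a, bigO0 5 (fun tau => X (t + a * tau) -
      (\sum_(k < 5) (tau ^+ k)%:C *: ((a ^+ k / k`!%:R)%:C *: G k)) *m X t).
  by move=> dX a; exact: (solution_taylor Q dQ X t a dX).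
have G0 : G 0 = 1%:M by [].
have [c1 c2 c3 c4] := order_conditions s sb _ _ _ _ _ _ _ erefl T2E T3E T4E.
(* Of [G] only G_0 = 1, the Taylor expansions and the four coefficient identities are kept. *)
move: G G0 taylor c1 c2 c3 c4 {T2E T3E T4E} => G G0 taylor c1 c2 c3 c4.
pose Tc k := match k with 0 => 1%:M | 1 => G 1 | 2 => T2 | 3 => T3 | _ => T4 end.
pose B a k := (a ^+ k / k`!%:R)%:C *: G k.
pose P tau := \sum_(k < 5) (tau ^+ k)%:C *: Tc k.
pose E a tau := \sum_(k < 5) (tau ^+ k)%:C *: B a k.
have order k : (k < 5)%N -> B s k = \sum_(j < k.+1) Tc j *m B sb (k - j)%N.
  have B0 a : B a 0%N = 1%:M by rewrite /B expr0 fact0 divr1 scale1r.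
  have B1 a : B a 1%N = a%:C *: G 1 by rewrite /B expr1 divr1.
  case: k => [|[|[|[|[|//]]]]] _; rewrite !big_ord_recr big_ord0 /=.
  - by rewrite [B sb _]B0 B0 mul1mx add0r.
  - rewrite [B sb (1 - 0)%N]B1 [B sb _]B0 B1 add0r mul1mx mulmx1 c1.
    by rewrite addrC.
  - rewrite [B sb (2 - 1)%N]B1 [B sb (2 - 2)%N]B0 [LHS]c2 add0r /B.
    by mx_noncomm_ring; ring.
  - rewrite [B sb (3 - 2)%N]B1 [B sb (3 - 3)%N]B0 [LHS]c3 add0r /B.
    by mx_noncomm_ring; ring.
  - rewrite [B sb (4 - 3)%N]B1 [B sb (4 - 4)%N]B0 [LHS]c4 add0r /B.
    by mx_noncomm_ring; ring.
have PE : bigO0 5 (fun tau => E s tau - P tau *m E sb tau).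
  exact: bigO0_cauchy_product.
have PO : bigO0 0 P by exact: bigO0_poly.
have TO : (T = (fun tau : R => 1%:M + tau%:C *: G 1 + (tau ^+ 2)%:C *: T2
                      + (tau ^+ 3)%:C *: T3 + (tau ^+ 4)%:C *: T4)
      +O_ (0^'+) (powC 5)) <-> bigO0 5 (fun tau => T tau - P tau).
  rewrite eqaddO_bigO0 (_ : (fun tau => T tau - P tau) = (fun tau => T tau -
    (1%:M + tau%:C *: G 1 + (tau ^+ 2)%:C *: T2
                      + (tau ^+ 3)%:C *: T3 + (tau ^+ 4)%:C *: T4)))//.
  apply/funext => tau; rewrite /P !big_ord_recr big_ord0 /= expr0 expr1.
  by rewrite add0r scale1r.
have {}taylor p (X : R -> 'M[R[i]]_(N, p)) : (forall u, mderiv X u (Q 0 u *m X u)) ->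
    forall a, bigO0 5 (fun tau => X (t + a * tau) - E a tau *m X t) := taylor p X.
rewrite TO; split=> [Tapp|TP x solx].
- have [X [X0 dX]] :=
    linear_ode_exists (Q 0) t (mderiv_mcontinuous _ _ dQ0) (1%:M : 'M[R[i]]_N).
  have XO : bigO0 5 (fun tau => X (t + s * tau) - T tau *m X (t + sb * tau)).
    apply: bigO0_col => j.
    have dcol u : mderiv (fun u => col j (X u)) u (Q 0 u *m col j (X u)).
      rewrite (_ : (fun u => col j (X u)) = (fun u => X u *m delta_mx j 0)).
        apply: mderiv_eq (mderivM _ _ _ _ _ (dX u) (mderiv_cst (delta_mx j 0) u)) _.
        by rewrite mulmx0 addr0 colE mulmxA.
      by apply/funext => v; rewrite colE.
    have /eqaddO_bigO0 := Tapp _ (fun u => proj2 (cderivP _ _ _) (dcol u)).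
    move=> /bigO0_ext; apply => tau.
    by rewrite linearB /= !colE mulmxA.
  have X1 : bigO0 1 (fun tau => X (t + sb * tau) - 1%:M).
    have [M hM] := taylor_mnorm1 0 (fun=> X) t _ (fun k => ltac:(by [])) (dX t).
    exists (M * `|sb|); have := near0_scale_right _ sb hM.
    apply: filterS2 (nbhs_right_gt 0) => tau t0.
    rewrite big_ord1 expr0 fact0 divr1 scale1r X0 !expr1 normrM (gtr0_norm t0).
    by rewrite mulrA.
  apply: (bigO0_mulmx_cancel _ _ (fun tau => X (t + sb * tau))) => //.
  (* With X_a = X(t + a tau), the error telescopes: (T - P) X_sb = -(X_s - T X_sb) + (X_s - E_s) +
     (E_s - P E_sb) - P (X_sb - E_sb). *)
  have h1 := taylor _ _ dX s; have h2 := taylor _ _ dX sb.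
  have h3 := bigO0M 0 5 _ _ PO h2.
  apply: bigO0_ext (bigO0D _ _ _ (bigO0D _ _ _ (bigO0N _ _ XO) h1)
    (bigO0D _ _ _ PE (bigO0N _ _ h3))) _ => tau /=.
  rewrite X0 !mulmx1.
  by mx_noncomm_ring; ring.
- apply/eqaddO_bigO0.
  have dx u : mderiv x u (Q 0 u *m x u) by apply/cderivP/solx.
  have h1 := taylor _ _ dx s; have h2 := taylor _ _ dx sb.
  have x0 := bigO0_cst (x t).
  (* Boundedness of x near t is read off from its Taylor expansion. *)
  have xO : bigO0 0 (fun tau => x (t + sb * tau)).
    have := bigO0D _ _ _ (bigO0_le 0 5 _ isT h2)
      (bigO0M 0 0 _ _ (bigO0_poly 5 (B sb)) x0).
    by move=> /bigO0_ext; apply => tau; rewrite subrK.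
  (* The same telescoping, solved for the scheme error: x_s - T x_sb = (x_s - E_s x(t)) - (T - P)
     x_sb + (E_s - P E_sb) x(t) - P (x_sb - E_sb x(t)). *)
  have h3 := bigO0M 0 5 _ _ PO h2; have h4 := bigO0M 5 0 _ _ TP xO.
  have h5 := bigO0M 5 0 _ _ PE x0.
  apply: bigO0_ext (bigO0D _ _ _ (bigO0D _ _ _ h1 (bigO0N _ _ h4))
    (bigO0D _ _ _ h5 (bigO0N _ _ h3))) _ => tau /=.
  by mx_noncomm_ring; ring.
Qed.

Theorem mainTheorem1 (R : realType) (N : nat) (Q : R -> 'M[R[i]]_N)
  (t s : R) (T : R -> 'M[R[i]]_N) :
  of_class_C 4 Q ->
  let sb := s - 1 in
  let Q0 := Q t in
  let Q' := cderiven 1 Q t in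
  let Q'' := cderiven 2 Q t in
  let Q''' := cderiven 3 Q t in
  let Q2 := Q' + Q0 ^+ 2 in
  let Q3 := Q'' + 2%:R *: (Q' * Q0) + Q0 * Q' + Q0 ^+ 3 in
  let Q4 := Q''' + 3%:R *: (Q'' * Q0) + Q0 * Q'' + 3%:R *: Q' ^+ 2
            + 3%:R *: (Q' * Q0 ^+ 2) + 2%:R *: (Q0 * Q' * Q0)
            + Q0 ^+ 2 * Q' + Q0 ^+ 4 in
  let T2 := ((2 * s - 1) / 2`!%:R)%:C *: Q2 - sb%:C *: Q0 ^+ 2 in
  let T3 := ((3 * s ^+ 2 - 3 * s + 1) / 3`!%:R)%:C *: Q3
            - (sb ^+ 2 / 2`!%:R)%:C *: (Q0 * Q2)
            - ((2 * s - 1) * sb / 2`!%:R)%:C *: (Q2 * Q0)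
            + (sb ^+ 2)%:C *: Q0 ^+ 3 in
  let T4 := ((2 * s - 1) * (2 * s ^+ 2 - 2 * s + 1) / 4`!%:R)%:C *: Q4
            - (sb ^+ 3 / 3`!%:R)%:C *: (Q0 * Q3)
            - (sb ^+ 2 / 2`!%:R)%:C *: (T2 * Q2)
            - sb%:C *: (T3 * Q0) in
  approximates_with_order 4 Q t s T <->
  T = (fun tau : R => 1%:M + tau%:C *: Q0 + (tau ^+ 2)%:C *: T2
                      + (tau ^+ 3)%:C *: T3 + (tau ^+ 4)%:C *: T4)
      +O_ (0^'+) (powC 5).
Proof.
move=> [Q_C4 _]; pose D k := cderiven k Q.
have dD k : (k < 4)%N -> forall u, mderiv (D k) u (D k.+1 u).
  by move=> k4 u; apply/cderivP; split => //; exact: Q_C4.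
(* With D opaque, conversion cannot unfold the limits hidden in cderiven. *)
change (cderiven 1 Q) with (D 1); change (cderiven 2 Q) with (D 2).
change (cderiven 3 Q) with (D 3).
have D0 : Q = D 0 by [].
rewrite D0; clearbody D; clear Q Q_C4 D0.
move=> sb Q0 Q' Q'' Q''' Q2 Q3 Q4 T2 T3 T4.
have mulE (A B : 'M[R[i]]_N) : A * B = A *m B by [].
have exprE (A : 'M[R[i]]_N) : (A ^+ 2 = A *m A) * (A ^+ 3 = A *m A *m A) *
    (A ^+ 4 = A *m A *m A *m A).
  by rewrite !exprSr expr0 mul1r.
have G2 : Q2 = evolution_coef D 2 t by rewrite /Q2 exprE.
have G3 : Q3 = evolution_coef D 3 t.
  by rewrite /Q3 exprE !mulE.
have G4 : Q4 = evolution_coef D 4 t.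
  by rewrite /Q4 !exprE !mulE !mulmxA.
apply: (approximates_order4P D t s T T2 T3 T4 dD).
- by rewrite -G2 /T2 exprE.
- by rewrite -G3 -G2 /T3 exprE !mulE mulmxA.
- by rewrite -G4 -G3 -G2 /T4 !mulE.
Qed.
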